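(* Let $\mathcal{I}$ be an ideal on $\omega$. Then the following statements are equivalent: (a) $\mathcal{I}$ is Ramsey. (b) $\mathcal{I}^+\longrightarrow *(\mathcal{I}^+)^r$ holds for all $r\geq 1$.
   Context: An ideal on $\omega$ is a family $\mathcal{I}\subseteq\wp(\omega)$ containing all finite sets, with $\omega\notin\mathcal{I}$, closed under subsets and finite unions. $\mathcal{I}^+$ is the family of infinite subsets of $\omega$ not in $\mathcal{I}$. $[A]^r$ is the family of subsets of $A$ of size $r$. $\mathcal{I}$ is Ramsey if for every $A\in\mathcal{I}^+$ and every $\pi:[A]^2\to 2$ there is $H\in\mathcal{I}^+$, $H\subseteq A$, such that $\pi$ is constant on $[H]^2$. For $r\geq 1$, $x\in[\omega]^r$ with increasing enumeration $x=\{x_i:i<r\}$, and $\Gamma\subseteq r=\{0,\dots,r-1\}$, put $x\restriction\Gamma=\{x_i:i\in\Gamma\}$. A coloring $f:[A]^r\to\omega$ ($A$ an infinite subset of $\omega$) is canonical on an infinite set $C\subseteq A$ if there is $\Gamma\subseteq r$ such that for all $x,y\in[C]^r$: $f(x)=f(y)$ if and only if $x\restriction\Gamma=y\restriction\Gamma$. The relation $\mathcal{I}^+\longrightarrow *(\mathcal{I}^+)^r$ means: for every $A\in\mathcal{I}^+$ and every coloring $f:[A]^r\to\omega$ there is $C\in\mathcal{I}^+$, $C\subseteq A$, such that $f$ is canonical on $C$. *)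

(* Defs.v *)
From mathcomp Require Import all_boot finmap.
From mathcomp Require Import boolp classical_sets cardinality.

Set Implicit Arguments.
Unset Strict Implicit.
Unset Printing Implicit Defensive.

Local Open Scope classical_set_scope.

Definition is_ideal (I : set (set nat)) : Prop :=
  [/\ forall A, finite_set A -> I A,
      ~ I setT,
      forall A B, A `<=` B -> I B -> I A &
      forall A B, I A -> I B -> I (A `|` B)].

Definition positive (I : set (set nat)) : set (set nat) :=
  [set A | infinite_set A /\ ~ I A].

Definition subsets_of_size (A : set nat) (r : nat) : set {fset nat} :=
  [set x | [set` x] `<=` A /\ #|` x| = r].

(* A coloring of [A]^r is given by a total function on {fset nat}; only its
   values on subsets_of_size A r are ever used. *)

Definition constant_on (T : Type) (f : {fset nat} -> T)
    (X : set {fset nat}) : Prop :=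
  forall x y, X x -> X y -> f x = f y.

Definition ramsey_ideal (I : set (set nat)) : Prop :=
  forall A, positive I A -> forall p : {fset nat} -> 'I_2,
  exists H, [/\ positive I H, H `<=` A &
    constant_on p (subsets_of_size H 2)].

(* x_i is the i-th entry of the increasing listing of x; the default value of
   nth is never reached when x has size r. *)
Definition restr (r : nat) (x : {fset nat}) (G : {set 'I_r}) : {fset nat} :=
  [fset nth 0 (sort leq x) (i : 'I_r) | i in G]%fset.

Definition canonical_on (r : nat) (f : {fset nat} -> nat) (C : set nat) : Prop :=
  exists G : {set 'I_r}, forall x y,
    subsets_of_size C r x -> subsets_of_size C r y ->
    (f x = f y <-> restr x G = restr y G).

Definition canonical_arrow (I : set (set nat)) (r : nat) : Prop :=
  forall A, positive I A -> forall f : {fset nat} -> nat,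
  exists C, [/\ positive I C, C `<=` A & canonical_on r f C].

(* Main.v *)
Require Import Defs.
From mathcomp Require Import all_boot finmap zify.
From mathcomp Require Import boolp classical_sets cardinality.

(** For (b) => (a), read a 2-coloring of pairs as a coloring by naturals and
    take a positive set C on which it is canonical for some Gamma.  If Gamma is
    empty the coloring is constant on the pairs of C.  Otherwise disjoint pairs
    have distinct restrictions to Gamma, hence distinct colors, and three
    disjoint pairs contradict that there are two colors
    ([canonical_arrow2_ramsey]).

    For (a) => (b), the first half lifts the partition property from pairs with
    two colors to every exponent and every finite set of colors
    ([ramsey_exponent]).  The induction on the exponent removes the dependence
    on the largest element: each x carries the sequence of colors of the sets
    {x} u s, indexed by the finite sets s, and on a positive set where the
    lexicographic comparison of these sequences is homogeneous, each coordinate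
    is eventually constant ([stabilize]).  One more use of the pair property
    spaces out the elements so that, in the resulting positive set, the color
    of {x} u s no longer depends on x above s ([end_homogeneous]).

    The second half is an Erdos-Rado argument.  Color each 2r-set by the
    equalities that f satisfies among its r-subsets; on a positive homogeneous
    set H, whether f(x) = f(y) depends only on the relative order of x and y.
    Through the increasing enumeration of H this becomes a coloring F of r-sets
    of naturals with the same invariance ([order_invariant]).  Let Gamma be the
    positions i at which moving only the i-th element, without passing any
    other, changes the color; by invariance one test pair decides this.
    Irrelevant positions can be moved one after another without changing the
    color ([eq_off_relevant]).  Conversely, if F(a) = F(b), every relevant a_i
    is a relevant b_j ([relevant_shared]): otherwise spread the sets out and
    shift the irrelevant elements of b away from a_i; then a_i can be moved
    without changing its order relative to b, so without changing the color,
    contradicting its relevance. *)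

Set Implicit Arguments.
Unset Strict Implicit.
Unset Printing Implicit Defensive.

Local Open Scope classical_set_scope.

(** * Increasing enumerations *)

Lemma infinite_above (A : set nat) n :
  infinite_set A -> exists2 x, A x & n <= x.
Proof.
move=> infA; apply: contrapT => noA; apply: infA.
apply: (sub_finite_set _ (finite_II n)) => x Ax /=.
by rewrite ltnNge; apply/negP => nx; apply: noA; exists x.
Qed.

Lemma infinite_enum (A : set nat) : infinite_set A ->
  exists e : nat -> nat,
    [/\ {homo e : i j / i < j}, forall i, A (e i) &
        forall x, A x -> exists i, e i = x].
Proof.
move=> infA.
have next n : exists x, [/\ A x, n <= x & forall y, A y -> n <= y -> x <= y].
  have exA : exists x, `[< A x >] && (n <= x).
    have [x Ax nx] := infinite_above n infA; exists x.
    by rewrite nx andbT; apply/asboolP.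
  exists (ex_minn exA); case: ex_minnP => x /andP[/asboolP Ax nx] minx.
  by split=> // y Ay ny; apply: minx; rewrite ny andbT; apply/asboolP.
have [g gP] := choice next.
pose e := fix e n := if n is m.+1 then g (e m).+1 else g 0.
have eS i : e i < e i.+1 by rewrite /=; have [] := gP (e i).+1.
have eA i : A (e i) by case: i => [|i] /=; [have [] := gP 0 | have [] := gP (e i).+1].
have ehomo : {homo e : i j / i < j} by apply: homo_ltn => //; apply: ltn_trans.
exists e; split=> // x Ax.
have ex_ge : exists i, x <= e i.
  exists x; elim: {Ax}x => // x; move: (eS x); lia.
case: (ex_minnP ex_ge) => i xi mini; exists i.
apply/eqP; rewrite eqn_leq xi andbT.
case: i xi mini => [|i] _ mini /=; first by have [_ _] := gP 0; apply.
have [_ _ ->//] := gP (e i).+1.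
by rewrite ltnNge; apply/negP => /mini; rewrite ltnn.
Qed.

Lemma sorted_sort_fset (x : {fset nat}) : sorted ltn (sort leq x).
Proof.
by rewrite ltn_sorted_uniq_leq sort_uniq fset_uniq sort_sorted //; apply: leq_total.
Qed.

Lemma sort_fset_seq (s : seq nat) :
  sorted ltn s -> sort leq [fset z in s]%fset = s.
Proof.
move=> ss; apply: (irr_sorted_eq ltn_trans ltnn) => //.
  exact: sorted_sort_fset.
by move=> z; rewrite mem_sort !inE.
Qed.

Lemma card_fset_sorted (s : seq nat) :
  sorted ltn s -> #|` [fset z in s]%fset| = size s.
Proof. by move=> ss; rewrite -[LHS](size_sort leq) sort_fset_seq. Qed.

(** An r-set is handled as the range of a function that increases on [0, r), so
    that changing one element or composing with an order embedding is an
    operation on functions. *)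
Definition increasing r (a : nat -> nat) :=
  forall i j, i < j -> j < r -> a i < a j.

Definition range_of r (a : nat -> nat) : {fset nat} :=
  [fset z in mkseq a r]%fset.

Lemma range_ofP r a z :
  reflect (exists2 i, i < r & z = a i) (z \in range_of r a).
Proof.
rewrite !inE; apply: (iffP mapP) => -[i ir ->]; exists i => //.
  by rewrite mem_iota in ir.
by rewrite mem_iota.
Qed.

Lemma eq_range_of r a b :
  (forall i, i < r -> a i = b i) -> range_of r a = range_of r b.
Proof.
move=> ab; rewrite /range_of; suff -> : mkseq a r = mkseq b r by []; apply/eq_in_map => i.
by rewrite mem_iota => /ab.
Qed.

Lemma range_of_comp r (h a : nat -> nat) :
  (h @` range_of r a)%fset = range_of r (h \o a).
Proof.
apply/fsetP => z; apply/imfsetP/range_ofP => /=.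
  by case=> y /range_ofP[i ir ->] ->; exists i.
by case=> i ir ->; exists (a i) => //; apply/range_ofP; exists i.
Qed.

Lemma sorted_mkseq r a : increasing r a -> sorted ltn (mkseq a r).
Proof.
move=> inca; apply/(sortedP 0) => i; rewrite size_mkseq => ir.
by rewrite !nth_mkseq ?(ltnW ir) //; apply: inca.
Qed.

Lemma sort_range_of r a : increasing r a -> sort leq (range_of r a) = mkseq a r.
Proof. by move=> /sorted_mkseq; apply: sort_fset_seq. Qed.

Lemma range_of_nth_sort r (x : {fset nat}) : #|` x| = r ->
  range_of r (nth 0 (sort leq x)) = x.
Proof.
move=> xr; apply/fsetP => z; rewrite !inE.
by rewrite -xr -(size_sort leq) mkseq_nth mem_sort.
Qed.

Lemma increasing_nth_sort r (x : {fset nat}) : #|` x| = r ->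
  increasing r (nth 0 (sort leq x)).
Proof.
move=> xr i j ij jr; apply: (sorted_ltn_nth ltn_trans) => //.
- exact: sorted_sort_fset.
- by rewrite inE size_sort xr (ltn_trans ij).
- by rewrite inE size_sort xr.
Qed.

Lemma restrP r (x : {fset nat}) (G : {set 'I_r}) z :
  reflect (exists2 i : 'I_r, i \in G & z = nth 0 (sort leq x) i)
          (z \in restr x G).
Proof. by rewrite /restr; apply: (iffP (imfsetP _ _ _ _)) => -[i /= iG ->]; exists i. Qed.

Lemma restr_sub r (x : {fset nat}) (G : {set 'I_r}) :
  #|` x| = r -> {subset restr x G <= x}.
Proof.
move=> xr z /restrP[i _ ->].
by rewrite -(mem_sort leq) mem_nth // size_sort xr.
Qed.

(** At the least position of disagreement, the smaller of the two values is
    missed by the other function: its earlier values are the shared ones, its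
    later values are too large. *)
Lemma eq_on_of_eq_image r (p : pred nat) a b :
  increasing r a -> increasing r b ->
  (forall i, i < r -> p i -> exists j, [/\ j < r, p j & a i = b j]) ->
  (forall i, i < r -> p i -> exists j, [/\ j < r, p j & b i = a j]) ->
  forall i, i < r -> p i -> a i = b i.
Proof.
move=> inca incb ab ba; elim/ltn_ind => i IH ir pi.
have [j [jr pj aij]] := ab i ir pi; have [k [kr pk bik]] := ba i ir pi.
case: (ltngtP j i) => [ji|ij|ji]; last by rewrite aij ji.
  by have := IH j ji jr pj; have := inca _ _ ji ir; lia.
case: (ltngtP k i) => [ki|ik|ki]; last by rewrite bik ki.
  by have := IH k ki kr pk; have := incb _ _ ki ir; lia.
by have := incb _ _ ij jr; have := inca _ _ ik kr; lia.
Qed.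

(** * From pairs to all finite exponents *)

Lemma ramsey_rel (I : set (set nat)) (A : set nat) (P : nat -> nat -> Prop) :
  ramsey_ideal I -> positive I A ->
  exists H, [/\ positive I H, H `<=` A &
    (forall x y, H x -> H y -> x < y -> P x y) \/
    (forall x y, H x -> H y -> x < y -> ~ P x y)].
Proof.
move=> ramI posA.
pose p (s : {fset nat}) : 'I_2 :=
  if `[< P (nth 0 (sort leq s) 0) (nth 0 (sort leq s) 1) >] then ord_max else ord0.
have [H [posH HA homH]] := ramI A posA p.
have pE x y : x < y -> p [fset z in [:: x; y]]%fset = if `[< P x y >] then ord_max else ord0.
  by move=> xy; rewrite /p sort_fset_seq //= xy.
have pair x y : H x -> H y -> x < y -> subsets_of_size H 2 [fset z in [:: x; y]]%fset.
  move=> Hx Hy xy; split; last by rewrite card_fset_sorted //= xy.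
  by move=> z /=; rewrite !inE orbF => /orP[] /eqP ->.
exists H; split=> //.
have [infH _] := posH.
have [x0 Hx0 _] := infinite_above 0 infH.
have [y0 Hy0 xy0] := infinite_above x0.+1 infH.
have [P0|nP0] := pselect (P x0 y0); [left|right] => x y Hx Hy xy.
  have := homH _ _ (pair _ _ Hx Hy xy) (pair _ _ Hx0 Hy0 xy0).
  by rewrite !pE // (asboolT P0); case: asboolP.
have := homH _ _ (pair _ _ Hx Hy xy) (pair _ _ Hx0 Hy0 xy0).
by rewrite !pE // (asboolF nP0); case: asboolP.
Qed.

Definition lex_lt (u v : nat -> nat) :=
  exists n, (forall i, i < n -> u i = v i) /\ u n < v n.

(** A nonincreasing function is constant once it has reached its minimum. *)
Lemma nonincreasing_stable (B : set nat) m (h : nat -> nat) :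
  infinite_set B ->
  (forall x y, B x -> B y -> m <= x -> x < y -> h y <= h x) ->
  exists m', forall x y, B x -> B y -> m' <= x -> m' <= y -> h x = h y.
Proof.
move=> infB hB.
have exv : exists v, `[< exists x, [/\ B x, m <= x & h x = v] >].
  by have [x Bx mx] := infinite_above m infB; exists (h x); apply/asboolP; exists x.
case: (ex_minnP exv) => v /asboolP[x0 [Bx0 mx0 hx0]] minv.
suff hv x : B x -> x0 < x -> h x = v.
  by exists x0.+1 => x y Bx By x0x x0y; rewrite !hv.
move=> Bx x0x; apply/eqP; rewrite eqn_leq -{1}hx0 hB //=.
apply: minv; apply/asboolP; exists x; split=> //; lia.
Qed.

(** If x < y always gives g x < g y lexicographically, or never does, then once
    the coordinates below n are constant, coordinate n is monotone in x; being
    bounded, it is eventually constant. *)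
Lemma stabilize (I : set (set nat)) (A : set nat) k (g : nat -> nat -> nat) :
  ramsey_ideal I -> positive I A -> (forall x n, g x n <= k) ->
  exists B, [/\ positive I B, B `<=` A &
    forall n, exists m, forall x y, B x -> B y -> m <= x -> m <= y ->
      forall i, i < n -> g x i = g y i].
Proof.
move=> ramI posA gk.
have [B [posB BA lexB]] := ramsey_rel (fun x y => lex_lt (g x) (g y)) ramI posA.
have [infB _] := posB.
exists B; split=> //; elim=> [|n [m IH]]; first by exists 0.
suff [m' m'P] : exists m', forall x y, B x -> B y -> m' <= x -> m' <= y -> g x n = g y n.
  exists (maxn m m') => x y Bx By; rewrite !geq_max => /andP[mx m'x] /andP[my m'y] i.
  by rewrite ltnS leq_eqVlt => /orP[/eqP ->|]; [apply: m'P | apply: IH].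
case: lexB => lexB; last first.
  apply: (@nonincreasing_stable B m (g^~ n)) => // x y Bx By mx xy.
  rewrite leqNgt; apply/negP => lt_n; apply: (lexB x y) => //.
  by exists n; split=> // i; apply: IH => //; lia.
(* In the increasing case coordinate n is nondecreasing; subtracting it from
   the bound k reduces to the nonincreasing one. *)
have [m' m'P] : exists m', forall x y, B x -> B y -> m' <= x -> m' <= y ->
    k - g x n = k - g y n.
  apply: (@nonincreasing_stable B m (fun x => k - g x n)) => // x y Bx By mx xy.
  apply: leq_sub2l; have [j [eqj ltj]] := lexB x y Bx By xy.
  case: (ltngtP n j) => [nj|jn|->]; last exact: ltnW.
    by rewrite eqj.
  by move: ltj; rewrite (IH x y) ?ltnn //; lia.
exists m' => x y Bx By m'x m'y; have := m'P x y Bx By m'x m'y.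
have := gk x n; have := gk y n; lia.
Qed.

(** Stabilization gives a bound M b beyond which the color of {x} u s is
    independent of x, for every s below b.  For a fixed x, the inequality
    M (x + 1) <= y fails for only finitely many y, so a homogeneous infinite set
    C satisfies it for all x < y; an element of C above s is then beyond the
    bound for s. *)
Lemma end_homogeneous (I : set (set nat)) (A : set nat) (T : finType)
    (c : {fset nat} -> T) :
  ramsey_ideal I -> positive I A ->
  exists C, [/\ positive I C, C `<=` A &
    forall (s : {fset nat}) x y, [set` s] `<=` C -> C x -> C y ->
      (forall z, z \in s -> z < x) -> (forall z, z \in s -> z < y) ->
      c (x |` s)%fset = c (y |` s)%fset].
Proof.
move=> ramI posA.
pose g x n : nat := if @choice.unpickle {fset nat} n is Some s
    then enum_rank (c (x |` s)%fset) : nat else 0.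
have gk x n : g x n <= #|T|.
  by rewrite /g; case: (choice.unpickle n) => // s; apply: ltnW.
have [B [posB BA stB]] := stabilize ramI posA gk.
have /choice[M MP] b : exists m, forall x y, B x -> B y -> m <= x -> m <= y ->
    forall s : {fset nat}, (forall z, z \in s -> z < b) ->
    c (x |` s)%fset = c (y |` s)%fset.
  pose codes := [seq choice.pickle s | s <- fpowerset [fset z in iota 0 b]%fset].
  have [m mP] := stB (\max_(n <- codes) n).+1.
  exists m => x y Bx By mx my s sb.
  have := mP x y Bx By mx my (choice.pickle s); rewrite /g choice.pickleK => eq_g.
  apply: enum_rank_inj; apply: val_inj; apply: eq_g.
  rewrite ltnS; apply: leq_bigmax_seq => //; apply: map_f.
  by rewrite fpowersetE; apply/fsubsetP => z /sb; rewrite !inE mem_iota.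
(* The conjunct M 0 <= x takes care of the empty s, which has no largest
   element below x. *)
have [C [posC CB spC]] :=
  ramsey_rel (fun x y => M 0 <= x /\ M x.+1 <= y) ramI posB.
have [infC _] := posC.
have {spC} spC : forall x y, C x -> C y -> x < y -> M 0 <= x /\ M x.+1 <= y.
  case: spC => // no.
  have [x Cx Mx] := infinite_above (M 0) infC.
  have [y Cy xy] := infinite_above (maxn x.+1 (M x.+1)) infC.
  by case: (no x y Cx Cy); [|split=> //]; lia.
exists C; split=> //; first exact: subset_trans CB BA.
move=> s x y sC Cx Cy sx sy.
have CM0 z : C z -> M 0 <= z.
  move=> Cz; have [t Ct zt] := infinite_above z.+1 infC.
  by have [] := spC z t Cz Ct zt.
have [s0|] := eqVneq s fset0.
  by apply: (MP 0); [exact: CB|exact: CB|exact: CM0|exact: CM0|rewrite s0].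
case/fset0Pn => z0 z0s.
have ex_mem : exists z, z \in s by exists z0.
have bnd z : z \in s -> z <= x by move=> /sx/ltnW.
case: (ex_maxnP ex_mem bnd) => b bs maxb.
have Cb : C b := sC b bs.
apply: (MP b.+1); [exact: CB|exact: CB| | |by move=> z /maxb].
  by have [] := spC b x Cb Cx (sx b bs).
by have [] := spC b y Cb Cy (sy b bs).
Qed.

(** On an end-homogeneous set the color of an (r+1)-set is that of its r-set of
    smaller elements, for the coloring that adds an arbitrary larger element. *)
Lemma ramsey_exponent (I : set (set nat)) r (T : finType) :
  ramsey_ideal I -> forall A, positive I A -> forall c : {fset nat} -> T,
  exists H, [/\ positive I H, H `<=` A & constant_on c (subsets_of_size H r)].
Proof.
move=> ramI; elim: r => [|r IH] A posA c.
  by exists A; split=> // x y [_ /cardfs0_eq ->] [_ /cardfs0_eq ->].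
have [C [posC CA endC]] := end_homogeneous c ramI posA.
have [infC _] := posC.
have /choice[nx nxP] (s : {fset nat}) : exists x, C x /\ forall z, z \in s -> z < x.
  have [x Cx sx] := infinite_above (\max_(z <- s) z).+1 infC.
  exists x; split=> // z zs; apply: leq_ltn_trans sx.
  exact: leq_bigmax_seq.
have [H [posH HC homH]] := IH C posC (fun s => c (nx s |` s)%fset).
exists H; split=> //; first exact: subset_trans HC CA.
suff split_max x : subsets_of_size H r.+1 x ->
    exists2 s, subsets_of_size H r s & c x = c (nx s |` s)%fset.
  move=> x y /split_max[s Hs ->] /split_max[t Ht ->]; exact: homH.
case=> xH xr.
have ex_mem : exists z, z \in x by apply/fset0Pn; rewrite -cardfs_gt0 xr.
have bnd z : z \in x -> z <= \max_(z <- x) z by move=> zx; apply: leq_bigmax_seq.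
case: (ex_maxnP ex_mem bnd) => m mx maxm.
have sx z : z \in (x `\ m)%fset -> z \in x by rewrite !inE => /andP[].
exists (x `\ m)%fset.
  split; first by move=> z /sx; apply: xH.
  by have := cardfsD1 m x; rewrite mx xr => -[].
rewrite -{1}(fsetD1K mx); have [Cnx ltnx] := nxP (x `\ m)%fset.
apply: endC => //; first by move=> z /sx zx; apply/HC/xH.
  exact/HC/xH.
by move=> z; rewrite !inE => /andP[zm zx]; rewrite ltn_neqAle zm maxm.
Qed.

(** * Order-invariant colorings *)

Lemma extend_sorted (H : set nat) N (w : seq nat) :
  infinite_set H -> sorted ltn w -> (forall z, z \in w -> H z) -> size w <= N ->
  exists t, [/\ sorted ltn (w ++ t), forall z, z \in w ++ t -> H z &
                size (w ++ t) = N].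
Proof.
move=> infH + + /subnK; move: (N - size w) => n.
elim: n w => [|n IH] w sw wH Nw; first by exists [::]; rewrite cats0.
have [x Hx wx] := infinite_above (\max_(z <- w) z).+1 infH.
have ltx z : z \in w -> z < x.
  by move=> zw; apply: leq_ltn_trans wx; apply: leq_bigmax_seq.
have [| | |t tP] := IH (rcons w x); last by exists (x :: t); rewrite -cat_rcons.
- by move: sw ltx; case: (w) => //= y w' pw ltx; rewrite rcons_path pw; apply/ltx/mem_last.
- by move=> z; rewrite mem_rcons inE => /orP[/eqP ->|/wH].
- by rewrite size_rcons addnS -addSn.
Qed.

(** Pairs of sets of positions stand for pairs of subsets of the N-set z, so the
    pattern records which subsets of z have equal colors. *)
Definition equality_pattern N (f : {fset nat} -> nat) (z : {fset nat}) :
    {ffun {set 'I_N} * {set 'I_N} -> bool} :=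
  [ffun p => f (restr z p.1) == f (restr z p.2)].

(** The images of s u t under h and k both extend to N-subsets of H by adding
    larger elements.  In both extensions s occupies the same positions, and so
    does t; the equality of colors is therefore read off from the common
    pattern. *)
Lemma pattern_transfer (H : set nat) N f (s t : {fset nat}) (h k : nat -> nat) :
  infinite_set H ->
  constant_on (equality_pattern N f) (subsets_of_size H N) ->
  #|` (s `|` t)%fset| <= N ->
  {in (s `|` t)%fset &, {homo h : x y / x < y}} -> (forall x, H (h x)) ->
  {in (s `|` t)%fset &, {homo k : x y / x < y}} -> (forall x, H (k x)) ->
  f (h @` s)%fset = f (h @` t)%fset -> f (k @` s)%fset = f (k @` t)%fset.
Proof.
move=> infH hom cardN; set u := sort leq (s `|` t)%fset.
have su : sorted ltn u := sorted_sort_fset _.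
have sizeu : size u <= N by rewrite size_sort.
have memu z : (z \in u) = (z \in (s `|` t)%fset) by rewrite mem_sort.
(* Positions from size u on hold the added elements. *)
pose pos (v : {fset nat}) := [set i : 'I_N | (i < size u) && (nth 0 u i \in v)]%SET.
have realize (g : nat -> nat) :
    {in (s `|` t)%fset &, {homo g : x y / x < y}} -> (forall x, H (g x)) ->
    exists2 z, subsets_of_size H N z &
      forall v : {fset nat}, (v `<=` s `|` t)%fset -> restr z (pos v) = (g @` v)%fset.
  move=> gmono gH.
  have sgu : sorted ltn (map g u).
    rewrite sorted_map; move: su; apply: sub_in_sorted (allss u) => x y.
    by rewrite /= !memu => xu yu; apply: gmono.
  have [||w [sw wH sizew]] := extend_sorted infH sgu (N := N).
  - by move=> z /mapP[x _ ->].
  - by rewrite size_map.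
  exists [fset z in map g u ++ w]%fset.
    by split; [move=> z /=; rewrite !inE -mem_cat; apply: wH | rewrite card_fset_sorted].
  move=> v /fsubsetP vsub; apply/fsetP => z.
  have nthg i : i < size u -> nth 0 (map g u ++ w) i = g (nth 0 u i).
    by move=> iu; rewrite nth_cat size_map iu (nth_map 0).
  apply/restrP/imfsetP => /=.
    case=> i; rewrite inE => /andP[iu iv] ->.
    by exists (nth 0 u i) => //; rewrite sort_fset_seq // nthg.
  case=> x xv ->.
  have xu : x \in u by rewrite memu vsub.
  have ltN : index x u < N by apply: leq_trans sizeu; rewrite index_mem.
  exists (Ordinal ltN); first by rewrite inE /= index_mem xu nth_index.
  by rewrite sort_fset_seq // nthg ?index_mem //= nth_index.
move=> hmono hH kmono kH.
have [x Hx xE] := realize h hmono hH; have [y Hy yE] := realize k kmono kH.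
have /ffunP/(_ (pos s, pos t)) := hom x y Hx Hy.
rewrite !ffunE /= !xE ?yE ?fsubsetUl ?fsubsetUr // => eqp hst.
by apply/eqP; rewrite -eqp hst.
Qed.

Definition order_invariant r (F : {fset nat} -> nat) :=
  forall (a b h : nat -> nat),
    {in (range_of r a `|` range_of r b)%fset &, {homo h : x y / x < y}} ->
    F (range_of r a) = F (range_of r b) <->
    F (range_of r (h \o a)) = F (range_of r (h \o b)).

Lemma order_invariant_pullback (H : set nat) r f (e : nat -> nat) :
  infinite_set H ->
  constant_on (equality_pattern (r + r) f) (subsets_of_size H (r + r)) ->
  {homo e : i j / i < j} -> (forall i, H (e i)) ->
  order_invariant r (fun s => f (e @` s)%fset).
Proof.
move=> infH hom emono eH a b h hmono.
have card_range c : #|` range_of r c| <= r.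
  by rewrite card_fseq -[X in _ <= X](size_mkseq c r) size_undup.
have cardN : #|` (range_of r a `|` range_of r b)%fset| <= r + r.
  by apply: leq_trans (leq_add (card_range a) (card_range b)); rewrite -cardfsUI leq_addr.
have imE c : (e @` range_of r (h \o c))%fset = ((e \o h) @` range_of r c)%fset.
  by rewrite !range_of_comp.
rewrite /= !imE.
have e_on : {in (range_of r a `|` range_of r b)%fset &, {homo e : x y / x < y}}.
  by move=> x y _ _; apply: emono.
have eh_on : {in (range_of r a `|` range_of r b)%fset &, {homo e \o h : x y / x < y}}.
  by move=> x y xu yu xy; apply/emono/hmono.
split.
  by apply: (pattern_transfer infH hom cardN) => // x; apply: eH.
by apply: (pattern_transfer infH hom cardN) => // x; apply: eH.
Qed.

Section Canonical.
Variables (r : nat) (F : {fset nat} -> nat).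
Hypothesis Finv : order_invariant r F.

(** The doubled naturals leave a gap above each element; [nudge i] is the
    doubling that moves its i-th value into that gap. *)
Definition nudge i j := j.*2 + (j == i).

Definition relevant (i : nat) : bool :=
  F (range_of r double) != F (range_of r (nudge i)).

(** Any two sets that differ only in their i-th elements are the image, under
    one order embedding, of the two sets that define [relevant]. *)
Lemma relevantE i a b : i < r -> increasing r a -> increasing r b ->
  (forall j, j < r -> j != i -> a j = b j) -> a i < b i ->
  F (range_of r a) != F (range_of r b) = relevant i.
Proof.
move=> ir inca incb ab abi; congr (~~ _).
(* 2i + 1 is the only odd number in the two ranges, so h takes from b only the
   value at i. *)
pose h n := if odd n then b n./2 else a n./2.
have ha : range_of r (h \o double) = range_of r a.
  by apply: eq_range_of => j jr; rewrite /= /h odd_double doubleK.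
have hb : range_of r (h \o nudge i) = range_of r b.
  apply: eq_range_of => j jr; rewrite /= /nudge /h addnC; case: eqVneq => [->|ji].
    by rewrite oddD odd_double (half_bit_double _ true).
  by rewrite odd_double doubleK ab.
have := @Finv double (nudge i) h; rewrite ha hb => inv.
suff hmono : {in (range_of r double `|` range_of r (nudge i))%fset &,
    {homo h : x y / x < y}}.
  by have {}inv := inv hmono; apply/eqP/eqP => /inv.
have shape n :
    n \in (range_of r double `|` range_of r (nudge i))%fset ->
    exists j (t : bool), [/\ j < r, t -> j = i & n = t + j.*2].
  rewrite inE => /orP[] /range_ofP[j jr ->]; first by exists j, false.
  by exists j, (j == i); split=> //; [move/eqP | rewrite /nudge addnC].
have hE (t : bool) j : h (t + j.*2) = if t then b j else a j.
  by rewrite /h half_bit_double oddD odd_double addbF oddb.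
move=> _ _ /shape[j [t [jr ti ->]]] /shape[k [v [kr vi ->]]]; rewrite !hE.
case: (ltngtP j k) => [jk _|kj|jk]; first last.
- rewrite jk; case: t v vi {ti} => -[] //= vi tv; try (by lia).
  by rewrite (vi isT).
- by case: {+}t; case: {+}v; lia.
have := inca _ _ jk kr; have := incb _ _ jk kr.
case: t v ti vi => -[] //= ti vi bjk ajk.
- by rewrite ab // -?(ti _) //; apply/eqP; lia.
- by rewrite (vi _) // in ajk *; apply: ltn_trans abi.
Qed.

(** Both sets can be raised to their pointwise maximum, which agrees with them
    at the relevant positions.  Raising the positions from the top down keeps
    every intermediate sequence increasing, and each step is an irrelevant
    move. *)
Lemma eq_off_relevant a b : increasing r a -> increasing r b ->
  (forall i, i < r -> relevant i -> a i = b i) ->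
  F (range_of r a) = F (range_of r b).
Proof.
suff up c d : increasing r c -> increasing r d -> (forall i, i < r -> c i <= d i) ->
    (forall i, i < r -> relevant i -> c i = d i) ->
    F (range_of r c) = F (range_of r d).
  move=> inca incb ab.
  have incm : increasing r (fun i => maxn (a i) (b i)).
    by move=> i j ij jr; have := inca i j ij jr; have := incb i j ij jr; lia.
  rewrite (up a (fun i => maxn (a i) (b i))) // => [|i ir|i ir /ab]; [|lia..].
  by rewrite [RHS](up b (fun i => maxn (a i) (b i))) // => [i ir|i ir /ab]; lia.
move=> incc incd cd eqcd.
pose mix k i := if i < k then c i else d i.
suff mixE k : k <= r -> F (range_of r (mix k)) = F (range_of r d).
  by rewrite -(mixE r) //; congr F; apply: eq_range_of => i ir; rewrite /mix ir.
have inc_mix m : increasing r (mix m).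
  move=> i j ij jr; rewrite /mix; have := incc i j ij jr; have := incd i j ij jr.
  have := cd i (ltn_trans ij jr); case: (ltnP i m); case: (ltnP j m); lia.
elim: k => [|k IH] kr; first by congr F; apply: eq_range_of.
rewrite -IH; last exact: ltnW.
have offk j : j != k -> mix k.+1 j = mix k j.
  by move=> jk; rewrite /mix ltnS leq_eqVlt (negbTE jk).
have atk : mix k.+1 k = c k /\ mix k k = d k by rewrite /mix ltnSn ltnn.
case: (ltngtP (c k) (d k)) (cd k kr) => // [ltk _|eqk _].
  apply/eqP; rewrite -[_ == _]negbK (relevantE (i := k)) //.
  - by apply/negP => /(eqcd k kr); lia.
  - by move=> j _; apply: offk.
  - by case: atk => -> ->.
congr F; apply: eq_range_of => j jr.
by case: (eqVneq j k) => [->|/offk //]; case: atk => -> ->.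
Qed.

(** Tripling leaves two free places above each value.  The irrelevant values of
    b go to the second one, at no cost in color; a_i, being different from every
    relevant value of b, can then be moved to the first one without crossing or
    meeting the modified b, so the color of a does not change and i is not
    relevant. *)
Lemma relevant_shared a b : increasing r a -> increasing r b ->
  F (range_of r a) = F (range_of r b) ->
  forall i, i < r -> relevant i -> exists j, [/\ j < r, relevant j & a i = b j].
Proof.
move=> inca incb Fab i ir reli; apply: contrapT => nob.
have avoid j : j < r -> relevant j -> a i <> b j by move=> jr relj ab; apply: nob; exists j.
pose a3 j := 3 * a j; pose b3 j := 3 * b j + if relevant j then 0 else 2.
have inca3 : increasing r a3 by move=> j k jk kr; have := inca j k jk kr; rewrite /a3; lia.
have Fab3 : F (range_of r a3) = F (range_of r b3).
  have -> : F (range_of r b3) = F (range_of r (muln 3 \o b)).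
    apply: eq_off_relevant => [j k jk kr|j k jk kr|j jr relj] /=.
    - by have := incb j k jk kr; rewrite /b3; do 2 case: ifP => _; lia.
    - by have := incb j k jk kr; lia.
    - by rewrite /b3 relj addn0.
  by apply/(Finv (a := a) (b := b) (h := muln 3)) => // x y _ _; lia.
pose h n := n + (n == a3 i).
have hb3 : range_of r (h \o b3) = range_of r b3.
  apply: eq_range_of => j jr; rewrite /= /h; case: eqP => [|_]; last by rewrite addn0.
  rewrite /a3 /b3; case: ifP => [relj|_]; last by lia.
  by have := avoid j jr relj; lia.
have hmono : {in (range_of r a3 `|` range_of r b3)%fset &, {homo h : x y / x < y}}.
  move=> x y _ + xy; rewrite inE /h => /orP[] /range_ofP[j jr yE];
    by move: xy; rewrite yE /a3 /b3; try case: ifP => _; do 2 case: eqP => ? //=; lia.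
have := Finv hmono; rewrite hb3 => -[/(_ Fab3) Fh _].
have : F (range_of r a3) != F (range_of r (h \o a3)).
  rewrite (relevantE (i := i)) //.
  - move=> j k jk kr; have := inca3 j k jk kr.
    by rewrite /= /h /a3; do 2 case: eqP => ? //=; lia.
  - move=> j jr ji; rewrite /= /h; case: eqP => [aji|_]; last by rewrite addn0.
    by case: (ltngtP j i) ji => [ji|ij|//] _; [have := inca3 j i ji ir|have := inca3 i j ij jr]; lia.
  - by rewrite /= /h eqxx addn1.
by rewrite Fab3 Fh eqxx.
Qed.

Lemma order_invariant_canonical a b : increasing r a -> increasing r b ->
  F (range_of r a) = F (range_of r b) <->
  (forall i, i < r -> relevant i -> a i = b i).
Proof.
move=> inca incb; split; last exact: eq_off_relevant.
by move=> Fab; apply: eq_on_of_eq_image => //; apply: relevant_shared.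
Qed.

End Canonical.

(** * The canonical partition relation *)

(** Exponent 2r suffices, since two r-sets have at most 2r elements between
    them. *)
Lemma ramsey_canonical (I : set (set nat)) r :
  ramsey_ideal I -> canonical_arrow I r.
Proof.
move=> ramI A posA f.
have [H [posH HA homH]] :=
  ramsey_exponent (r + r) ramI posA (equality_pattern (r + r) f).
exists H; split=> //.
have [infH _] := posH.
have [e [emono eH eonto]] := infinite_enum infH.
pose F (s : {fset nat}) := f (e @` s)%fset.
have Finv : order_invariant r F by exact: order_invariant_pullback homH emono eH.
pose G := [set i : 'I_r | relevant r F i]%SET.
have index_of x : subsets_of_size H r x ->
    exists2 a, increasing r a & x = range_of r (e \o a).
  case=> xH xr; have /choice[a aP] i : exists n, i < r -> e n = nth 0 (sort leq x) i.
    have [ir|nir] := ltnP i r; last by exists 0; lia.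
    have [|n nP] := eonto (nth 0 (sort leq x) i); last by exists n.
    by apply: xH => /=; rewrite -(mem_sort leq) mem_nth // size_sort xr.
  exists a; last first.
    by rewrite -[LHS](range_of_nth_sort xr); apply: eq_range_of => i /aP.
  move=> i j ij jr; have := increasing_nth_sort xr ij jr.
  rewrite -!aP ?(ltn_trans ij) //; rewrite !ltnNge; apply: contra.
  by rewrite leq_eqVlt => /orP[/eqP ->|/emono/ltnW].
exists G => x y /index_of[a inca ->] /index_of[b incb ->].
have ince c : increasing r c -> increasing r (e \o c).
  by move=> incc i j ij jr; apply/emono/incc.
have einj i j : e i = e j -> i = j.
  by case: (ltngtP i j) => // /emono; lia.
have nthE c i : increasing r c -> i < r -> nth 0 (sort leq (range_of r (e \o c))) i = e (c i).
  by move=> incc ir; rewrite sort_range_of ?nth_mkseq //; apply: ince.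
have -> : f (range_of r (e \o a)) = F (range_of r a) by rewrite /F range_of_comp.
have -> : f (range_of r (e \o b)) = F (range_of r b) by rewrite /F range_of_comp.
rewrite order_invariant_canonical //; split=> [ab|restr_ab].
  apply/fsetP => z; apply/restrP/restrP => -[i iG ->]; exists i => //;
    by rewrite !nthE // ab //; move: iG; rewrite inE.
have selected c d : increasing r c -> increasing r d ->
    restr (range_of r (e \o c)) G = restr (range_of r (e \o d)) G ->
    forall i, i < r -> relevant r F i -> exists j, [/\ j < r, relevant r F j & c i = d j].
  move=> incc incd cd i ir reli.
  have : e (c i) \in restr (range_of r (e \o c)) G.
    by apply/restrP; exists (Ordinal ir); rewrite ?inE // nthE.
  rewrite cd => /restrP[j]; rewrite inE nthE // => relj /einj ->.
  by exists j.
by apply: eq_on_of_eq_image => //; apply: selected.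
Qed.

Lemma canonical_arrow2_ramsey (I : set (set nat)) :
  canonical_arrow I 2 -> ramsey_ideal I.
Proof.
move=> can A posA p.
have [C [posC CA [G canG]]] := can A posA p.
exists C; split=> //.
have [G0|[i iG]] := set_0Vmem G.
  move=> x y xC yC; apply/ord_inj/canG => //.
  by apply/fsetP => z; apply/restrP/restrP => -[i]; rewrite G0 inE.
have [infC _] := posC.
have [e [emono eC _]] := infinite_enum infC.
pose pair k := range_of 2 (fun j => e (k.*2 + j)).
have inc_pair k : increasing 2 (fun j => e (k.*2 + j)).
  by move=> j l jl _; apply: emono; rewrite ltn_add2l.
have pairC k : subsets_of_size C 2 (pair k).
  split; first by move=> z /= /range_ofP[j _ ->].
  by rewrite card_fset_sorted ?size_mkseq //; apply: sorted_mkseq.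
have p_inj : injective (fun k : 'I_3 => p (pair k)).
  move=> k l /(congr1 val)/canG => /(_ (pairC k) (pairC l)) kl; apply: ord_inj.
  pose z := nth 0 (sort leq (pair k)) i.
  have zk : z \in restr (pair k) G by apply/restrP; exists i.
  have zl : z \in restr (pair l) G by rewrite -kl.
  have [_ sk] := pairC k; have [_ sl] := pairC l.
  have /range_ofP[j j2 zj] := restr_sub sk zk.
  have /range_ofP[m m2 zm] := restr_sub sl zl.
  have : k.*2 + j = l.*2 + m.
    have : e (k.*2 + j) = e (l.*2 + m) by rewrite -zj -zm.
    by case: (ltngtP (k.*2 + j) (l.*2 + m)) => // /emono; lia.
  by lia.
by have := leq_card _ p_inj; rewrite !card_ord.
Qed.

Theorem theorem3p30 (I : set (set nat)) (hI : is_ideal I) :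
  ramsey_ideal I <-> (forall r : nat, 1 <= r -> canonical_arrow I r).
Proof.
split=> [ramI r _|can]; first exact: ramsey_canonical.
exact/canonical_arrow2_ramsey/can.
Qed.
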